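(* Let $M$ satisfy $M^2=(1-s)(1-t)$. Then, as formal power series in $u$, $$\widehat{H}_0(s,t,q,u)=\frac{(s-1)\Big(\big(1-t\cos_q(Mu)\big)\cos_B(Mu;q)-t\sin_q(Mu)\sin_B(Mu;q)\Big)}{s+t\,\mathrm{e}_q(iMu)\,\mathrm{e}_q(-iMu)-(ts+1)\cos_q(Mu)},$$ $$\widehat{H}_1(s,t,q,u)=\frac{-M\Big(\big(s-\cos_q(Mu)\big)\sin_B(Mu;q)+\sin_q(Mu)\cos_B(Mu;q)\Big)}{s+t\,\mathrm{e}_q(iMu)\,\mathrm{e}_q(-iMu)-(ts+1)\cos_q(Mu)}.$$
   Context: $\mathfrak{B}_n$ is the group of permutations $\pi$ of $\{\pm1,\dots,\pm n\}$ with $\pi(-i)=-\pi(i)$; write $\pi_i=\pi(i)$ and set $\pi_0=0$. For $\pi\in\mathfrak{B}_n$: $\mathrm{odes}_B(\pi)$ is the number of odd $i\in\{0,\dots,n-1\}$ with $\pi_i>\pi_{i+1}$, and $\mathrm{easc}_B(\pi)$ is the number of even $i\in\{0,\dots,n-1\}$ with $\pi_i<\pi_{i+1}$. The type B inversion number is $$\mathrm{inv}_B(\pi)=|\{1\le i<j\le n:\pi_i>\pi_j\}|+|\{1\le i<j\le n:-\pi_i>\pi_j\}|+|\{1\le i\le n:\pi_i<0\}|.$$ Define $\hat B_n(s,t,q)=\sum_{\pi\in\mathfrak{B}_n}t^{\mathrm{odes}_B(\pi)}s^{\mathrm{easc}_B(\pi)}q^{\mathrm{inv}_B(\pi)}$,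 $B_n(1,q)=\sum_{\pi\in\mathfrak{B}_n}q^{\mathrm{inv}_B(\pi)}$ (both equal to $1$ for $n=0$), and $$\widehat{H}_0(s,t,q,u)=\sum_{n\ge0}\hat B_{2n}(s,t,q)\frac{u^{2n}}{B_{2n}(1,q)},\qquad \widehat{H}_1(s,t,q,u)=\sum_{n\ge0}\hat B_{2n+1}(s,t,q)\frac{u^{2n+1}}{B_{2n+1}(1,q)}.$$ $[j]_q=1+q+\cdots+q^{j-1}$, $[n]_q!=\prod_{j=1}^n[j]_q$, $\mathrm{e}_q(u)=\sum_{n\ge0}u^n/[n]_q!$, $\exp_B(u;q)=\sum_{n\ge0}u^n/B_n(1,q)$, and with $i^2=-1$: $\cos_q(u)=\frac{\mathrm{e}_q(iu)+\mathrm{e}_q(-iu)}2$, $\sin_q(u)=\frac{\mathrm{e}_q(iu)-\mathrm{e}_q(-iu)}{2i}$, $\cos_B(u;q)=\frac{\exp_B(iu;q)+\exp_B(-iu;q)}2$, $\sin_B(u;q)=\frac{\exp_B(iu;q)-\exp_B(-iu;q)}{2i}$. Here $s,t,q$ are indeterminates and the identities are between formal power series in $u$ over the field $\mathbb{Q}(s,t,q)(M,i)$. *)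

(* Defs.v *)
From HB Require Import structures.
From mathcomp Require Import all_boot all_order all_algebra all_fingroup all_field.
From mathcomp Require Export fraction mpoly.
From mathcomp Require boolp.

Set Implicit Arguments.
Unset Strict Implicit.
Unset Printing Implicit Defensive.

Import Order.TTheory GRing.Theory Num.Theory.

Local Open Scope ring_scope.

(* The point [(b, k)] stands for the integer [k + 1], negated when [b] is true,
   so that [spt n] is {-n, ..., -1, 1, ..., n}. *)
Definition spt (n : nat) : finType := (bool * 'I_n)%type.

Definition spt_int (n : nat) (x : spt n) : int :=
  if x.1 then - (x.2.+1)%:Z else (x.2.+1)%:Z.

Definition spt_opp (n : nat) (x : spt n) : spt n := (~~ x.1, x.2).

Lemma spt_intN n (x : spt n) : spt_int (spt_opp x) = - spt_int x.
Proof. by case: x => [[]] k; rewrite /spt_int /= ?opprK. Qed.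

Lemma spt_int_inj n : injective (@spt_int n).
Proof.
case=> [[] i] [[] j]; rewrite /spt_int //= => - [].
- by move/val_inj->.
- by move/val_inj->.
Qed.

Definition signed_perm (n : nat) : {set {perm spt n}} :=
  [set p : {perm spt n} | [forall x, p (spt_opp x) == spt_opp (p x)]].

(* [sp_val p i] is p(i) for 1 <= i <= n, and 0 for i = 0; its value for i > n
   is junk. *)
Definition sp_val (n : nat) (p : {perm spt n}) (i : nat) : int :=
  if i is j.+1 then
    if insub j is Some k then spt_int (p (false, k)) else 0
  else 0.

Definition odesB (n : nat) (p : {perm spt n}) : nat :=
  #|[set i : 'I_n | odd i && (sp_val p i.+1 < sp_val p i)]|.

Definition eascB (n : nat) (p : {perm spt n}) : nat :=
  #|[set i : 'I_n | ~~ odd i && (sp_val p i < sp_val p i.+1)]|.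

Definition invB (n : nat) (p : {perm spt n}) : nat :=
  (#|[set ij : 'I_n.+1 * 'I_n.+1 |
        (0 < ij.1 < ij.2)%N && (sp_val p ij.2 < sp_val p ij.1)%R]|
   + #|[set ij : 'I_n.+1 * 'I_n.+1 |
        (0 < ij.1 < ij.2)%N && (sp_val p ij.2 < - sp_val p ij.1)%R]|
   + #|[set i : 'I_n.+1 | (0 < i)%N && (sp_val p i < 0)%R]|)%N.

Definition Bhat (R : comNzRingType) (n : nat) (s t q : R) : R :=
  \sum_(p in signed_perm n) t ^+ odesB p * s ^+ eascB p * q ^+ invB p.

(* The polynomial B_n(1, q). *)
Definition Bone (R : comNzRingType) (n : nat) (q : R) : R :=
  \sum_(p in signed_perm n) q ^+ invB p.

Definition qint (R : comNzRingType) (j : nat) (q : R) : R :=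
  \sum_(k < j) q ^+ k.

Definition qfact (R : comNzRingType) (n : nat) (q : R) : R :=
  \prod_(1 <= j < n.+1) qint j q.

Record fps (K : Type) : Type := Fps { fcoef : nat -> K }.

HB.instance Definition _ (K : Type) := boolp.gen_eqMixin (fps K).
HB.instance Definition _ (K : Type) := boolp.gen_choiceMixin (fps K).

Lemma fpsP (K : Type) (f g : fps K) : fcoef f =1 fcoef g <-> f = g.
Proof. by case: f g => f [g]; split=> [/= /boolp.funext-> | [->]]. Qed.

Section FpsRing.

Variable K : fieldType.
Implicit Types f g h : fps K.

Definition fps_const (c : K) : fps K := Fps (fun n => if n is 0%N then c else 0).
Definition fps_add f g : fps K := Fps (fun n => fcoef f n + fcoef g n).
Definition fps_opp f : fps K := Fps (fun n => - fcoef f n).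
Definition fps_mul f g : fps K :=
  Fps (fun n => \sum_(k < n.+1) fcoef f k * fcoef g (n - k)).

Fact fps_addA : associative fps_add.
Proof. by move=> f g h; apply/fpsP=> n /=; rewrite addrA. Qed.
Fact fps_addC : commutative fps_add.
Proof. by move=> f g; apply/fpsP=> n /=; rewrite addrC. Qed.
Fact fps_add0 : left_id (fps_const 0) fps_add.
Proof. by move=> f; apply/fpsP=> -[|n] /=; rewrite add0r. Qed.
Fact fps_addN : left_inverse (fps_const 0) fps_opp fps_add.
Proof. by move=> f; apply/fpsP=> -[|n] /=; rewrite addNr. Qed.

HB.instance Definition _ :=
  GRing.isZmodule.Build (fps K) fps_addA fps_addC fps_add0 fps_addN.

Let trunc (N : nat) f : {poly K} := \poly_(i < N) fcoef f i.

Let fps_mulE N f g n : (n < N)%N ->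
  fcoef (fps_mul f g) n = (trunc N f * trunc N g)`_n.
Proof.
move=> ltnN; rewrite coefM; apply: eq_bigr => i _; rewrite !coef_poly.
by rewrite (leq_ltn_trans (leq_ord i)) // (leq_ltn_trans (leq_subr _ _)).
Qed.

Fact fps_mulA : associative fps_mul.
Proof.
move=> f g h; apply/fpsP=> n.
have E (p r : {poly K}) : (forall i, (i <= n)%N -> p`_i = r`_i) ->
    forall w : {poly K}, (p * w)`_n = (r * w)`_n.
  by move=> Epr w; rewrite !coefM; apply: eq_bigr => i _; rewrite Epr ?leq_ord.
have T f1 f2 i : (i <= n)%N ->
    (trunc n.+1 (fps_mul f1 f2))`_i = (trunc n.+1 f1 * trunc n.+1 f2)`_i.
  by move=> lein; rewrite coef_poly ltnS lein (@fps_mulE n.+1).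
rewrite !(@fps_mulE n.+1) // (E _ _ (T f g)) mulrC (E _ _ (T g h)).
by rewrite mulrC mulrA.
Qed.

Fact fps_mulC : commutative fps_mul.
Proof. by move=> f g; apply/fpsP=> n; rewrite !(@fps_mulE n.+1) // mulrC. Qed.

Fact fps_mul1 : left_id (fps_const 1) fps_mul.
Proof.
move=> f; apply/fpsP=> n /=; rewrite big_ord_recl subn0 mul1r big1 ?addr0 //.
by move=> i _; rewrite mul0r.
Qed.

Fact fps_mulDl : left_distributive fps_mul fps_add.
Proof.
move=> f g h; apply/fpsP=> n /=; rewrite -big_split.
by apply: eq_bigr => i _; rewrite mulrDl.
Qed.

Fact fps_oner_neq0 : fps_const 1 != 0.
Proof.
by apply/eqP=> /fpsP /(_ 0%N) /= /eqP; rewrite oner_eq0.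
Qed.

HB.instance Definition _ := GRing.Zmodule_isComNzRing.Build (fps K)
  fps_mulA fps_mulC fps_mul1 fps_mulDl fps_oner_neq0.

(* The first [n.+1] coefficients of the inverse of f, by course-of-values
   recursion: g_0 = 1 / f_0 and
   g_(n+1) = - (f_1 g_n + ... + f_(n+1) g_0) / f_0. *)
Fixpoint fps_inv_seq f (n : nat) : seq K :=
  if n is m.+1 then
    let r := fps_inv_seq f m in
    rcons r (- (fcoef f 0)^-1 * \sum_(k < m.+1) fcoef f k.+1 * r`_(m - k))
  else [:: (fcoef f 0)^-1].

Definition fps_unit : pred (fps K) := fun f => fcoef f 0 != 0.

Definition fps_inv f : fps K :=
  if fps_unit f then Fps (fun n => (fps_inv_seq f n)`_n) else f.

Let size_fps_inv_seq f n : size (fps_inv_seq f n) = n.+1.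
Proof. by elim: n => //= n IHn; rewrite size_rcons IHn. Qed.

Let nth_fps_inv_seq f n k :
  (k <= n)%N -> (fps_inv_seq f n)`_k = (fps_inv_seq f k)`_k.
Proof.
elim: n => [|n IHn]; first by case: k.
rewrite leq_eqVlt => /orP[/eqP-> // | ltkn] /=.
by rewrite nth_rcons size_fps_inv_seq ltkn IHn.
Qed.

Fact fps_mulVf : {in fps_unit, left_inverse 1 fps_inv *%R}.
Proof.
move=> f uf; rewrite mulrC /fps_inv ifT //; apply/fpsP=> -[|n] /=.
  by rewrite big_ord_recl big_ord0 addr0 mulfV.
rewrite big_ord_recl /= nth_rcons size_fps_inv_seq ltnn eqxx mulrA mulrN.
rewrite mulfV // mulN1r; apply/eqP; rewrite addrC subr_eq0; apply/eqP.
by apply: eq_bigr => i _; rewrite /= subSS (nth_fps_inv_seq _ (leq_subr _ _)).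
Qed.

Fact fps_unitPl f g : g * f = 1 -> fps_unit f.
Proof.
move=> /fpsP/(_ 0%N) /=; rewrite big_ord_recl big_ord0 addr0 subn0 => gf1.
by apply: contra_eq_neq gf1 => ->; rewrite mulr0 eq_sym oner_eq0.
Qed.

Fact fps_inv_out : {in [predC fps_unit], fps_inv =1 id}.
Proof. by move=> f; rewrite inE /fps_inv => /negPf uf; rewrite ifF. Qed.

HB.instance Definition _ := GRing.ComNzRing_hasMulInverse.Build (fps K)
  fps_mulVf fps_unitPl fps_inv_out.

(* The series f(c u). *)
Definition fps_scale (c : K) f : fps K := Fps (fun n => c ^+ n * fcoef f n).

(* A sum over n >= 0 of terms a_(2n) u^(2n) (resp. a_(2n+1) u^(2n+1)) is given
   by its coefficients, which vanish at odd (resp. even) indices. *)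
Definition Hhat0 (s t q : K) : fps K :=
  Fps (fun n => if odd n then 0 else Bhat n s t q / Bone n q).

Definition Hhat1 (s t q : K) : fps K :=
  Fps (fun n => if odd n then Bhat n s t q / Bone n q else 0).

Definition eq_fps (q : K) : fps K := Fps (fun n => (qfact n q)^-1).
Definition expB (q : K) : fps K := Fps (fun n => (Bone n q)^-1).

(* The cosine and sine attached to an exponential series [e], where [im] is
   meant to be a square root of -1. *)
Definition fps_cos (im : K) (e : fps K) : fps K :=
  (fps_scale im e + fps_scale (- im) e) / 2%:R.
Definition fps_sin (im : K) (e : fps K) : fps K :=
  (fps_scale im e - fps_scale (- im) e) / (2%:R * fps_const im).

Definition cosq (im q : K) : fps K := fps_cos im (eq_fps q).
Definition sinq (im q : K) : fps K := fps_sin im (eq_fps q).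
Definition cosB (im q : K) : fps K := fps_cos im (expB q).
Definition sinB (im q : K) : fps K := fps_sin im (expB q).

End FpsRing.

Notation "c %:S" := (fps_const c) (at level 2, format "c %:S") : ring_scope.

Definition Qstq : fieldType := {fraction {mpoly rat[3]}}.
Definition ind_s : Qstq := tofrac ('X_(@Ordinal 3 0 isT)).
Definition ind_t : Qstq := tofrac ('X_(@Ordinal 3 1 isT)).
Definition ind_q : Qstq := tofrac ('X_(@Ordinal 3 2 isT)).

(* Main.v *)
Require Import Defs.
From mathcomp Require Import all_boot all_order all_algebra all_fingroup all_field.
From mathcomp Require Import zify ring.

(** Expand over forced ascents: the weight of a signed permutation at position
    [i] is [tau_i + alpha_i * [pi_i < pi_(i+1)]], with [tau_i = 1] and
    [alpha_i = s - 1] for even [i], and [tau_i = t] and [alpha_i = 1 - t] for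
    odd [i]. Choosing [alpha] at a position forces an ascent there, so the sum
    over signed permutations breaks into increasing blocks, and splitting off
    the last block gives, for [G_n = Bhat_n / B_n(1, q)], the recurrence
    ([norm_sum_rec])

      [G_n = (prod_(i < n) alpha_i) / B_n(1, q)
             + sum_(m < n) tau_m G_m (prod_(m < i < n) alpha_i) / [n - m]_q!].

    Since [alpha_even * alpha_odd = (i M)^2], the products are powers of [i M]
    up to one factor [alpha], and the recurrence is a linear system for the
    even and the odd part of the series of the [G_n] ([Hhat0_eq], [Hhat1_eq]),
    whose coefficients are the q-sine and q-cosine at [M u]. Its determinant is,
    up to a unit, the denominator of the theorem, and Cramer's rule gives the two
    formulas ([solve_linear_system]).

    What makes the recurrence true is that an increasing block of length [k]
    after an unconstrained beginning of length [n] multiplies the inversion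
    generating function by [B_(n+k)(1, q) / (B_n(1, q) [k]_q!)]. This is proved
    by inserting letters one at a time at the end of the permutation. Inserting
    the last letter [v] into a signed permutation of size [n] adds to [invB] the
    number [code v], which depends on [v] alone and takes each of the values
    [0, ..., 2n+1] once ([sum_signed_permS], [invB_ins]), and whether an ascent
    is created depends only on [v] and the previous last letter
    ([asc_ins_max]). Hence the q-count of the increasing extensions by [k]
    letters depends only on the last letter, and it has a closed form in
    q-binomial coefficients ([incr_count], [incr_countS]): after a positive
    letter the new letters amount to a multiset of gaps above it, and after a
    negative one they split into a negative and a positive part. Summed
    over the first letter of the block, the closed form collapses by the
    q-binomial theorem ([block_negE], [block_neg_Bone]). *)

Import Order.TTheory GRing.Theory Num.Theory.
Local Open Scope ring_scope.

Set Implicit Arguments.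
Unset Strict Implicit.
Unset Printing Implicit Defensive.

#[local] Arguments sp_val : simpl never.

(** * Inserting a last letter into a signed permutation *)

Lemma sp_val_ord n (p : {perm spt n}) (k : 'I_n) :
  sp_val p k.+1 = spt_int (p (false, k)).
Proof. by rewrite /sp_val valK. Qed.

Lemma big_spt (R : Type) (idx : R) (op : Monoid.com_law idx) n (F : spt n -> R) :
  \big[op/idx]_x F x =
  op (\big[op/idx]_(i < n) F (true, i)) (\big[op/idx]_(i < n) F (false, i)).
Proof.
rewrite (eq_bigr (fun x : spt n => F (x.1, x.2))); last by case.
by rewrite -(pair_bigA _ (fun b i => F (b, i))) big_bool.
Qed.

Lemma sp_val0 n (p : {perm spt n}) : sp_val p 0 = 0.
Proof. by []. Qed.

Lemma spt_opp_signed n (p : {perm spt n}) : p \in signed_perm n ->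
  forall x, p (spt_opp x) = spt_opp (p x).
Proof. by rewrite inE => /forallP h x; apply/eqP/h. Qed.

(** The signed permutation of size [n.+1] whose last letter is [v] and whose
    other letters standardise to [p]: the absolute values at or above that of
    [v] are shifted up by [lift v.2]. *)
Definition ins_fun {n} (p : {perm spt n}) (v x : spt n.+1) : spt n.+1 :=
  if unlift ord_max x.2 is Some k
  then let y := p (x.1, k) in (y.1, lift v.2 y.2) else (x.1 (+) v.1, v.2).

Lemma ins_fun_inj n (p : {perm spt n}) v : injective (ins_fun p v).
Proof.
case=> b x [c y]; rewrite /ins_fun /=.
case: unliftP => [k ->|->]; case: unliftP => [l ->|->] /=.
- move=> e; have /= e1 := congr1 fst e; have /= /lift_inj e2 := congr1 snd e.
  have /perm_inj[-> ->//] : p (b, k) = p (c, l).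
  by rewrite [LHS]surjective_pairing [RHS]surjective_pairing e1 e2.
- by case=> _ /eqP; rewrite eq_sym (negPf (neq_lift _ _)).
- by case=> _ /eqP; rewrite (negPf (neq_lift _ _)).
- by case=> /addIb ->.
Qed.

Definition ins {n} (p : {perm spt n}) v : {perm spt n.+1} := perm (@ins_fun_inj n p v).

Lemma ins_lift n (p : {perm spt n}) v b k :
  ins p v (b, lift ord_max k) = ((p (b, k)).1, lift v.2 (p (b, k)).2).
Proof. by rewrite permE /ins_fun /= liftK. Qed.

Lemma ins_max n (p : {perm spt n}) v b :
  ins p v (b, ord_max) = (b (+) v.1, v.2).
Proof. by rewrite permE /ins_fun /= unlift_none. Qed.

Lemma ins_signed n (p : {perm spt n}) v :
  p \in signed_perm n -> ins p v \in signed_perm n.+1.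
Proof.
move=> /spt_opp_signed h; rewrite inE; apply/forallP => -[b x]; apply/eqP.
rewrite /spt_opp /=; case: (unliftP ord_max x) => [k ->|->].
  by rewrite !ins_lift -[(~~ b, k)]/(spt_opp (b, k)) h.
by rewrite !ins_max /= addNb.
Qed.

Lemma ins_onto n (p : {perm spt n.+1}) : p \in signed_perm n.+1 ->
  exists2 s, s \in signed_perm n & p = ins s (p (false, ord_max)).
Proof.
move=> hp; set v := p _.
have pmax b : p (b, ord_max) = (b (+) v.1, v.2).
  case: b; last by rewrite /= -surjective_pairing.
  by rewrite -[(true, _)]/(spt_opp (false, ord_max)) spt_opp_signed.
(* The absolute value of [v] is taken only at the last position, so that the
   other values can be unlifted. *)
have neqv b k : v.2 != (p (b, lift ord_max k)).2.
  apply/eqP => e; have := pmax ((p (b, lift ord_max k)).1 (+) v.1).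
  rewrite -addbA addbb addbF e -surjective_pairing => /perm_inj e'.
  have /eqP := congr1 snd e'.
  by rewrite /= ?[lift _ _ == _]eq_sym (negPf (neq_lift _ _)).
have [f fE] : exists f : spt n -> spt n, forall b k,
    p (b, lift ord_max k) = ((f (b, k)).1, lift v.2 (f (b, k)).2).
  exists (fun x => let y := p (x.1, lift ord_max x.2) in
                   (y.1, odflt x.2 (unlift v.2 y.2))) => b k /=.
  have /unlift_some[l e ->] := neqv b k.
  by rewrite /= -e -surjective_pairing.
have f_inj : injective f.
  case=> b k [c l] e; have := fE b k; rewrite e -fE => /perm_inj e'.
  have /= -> := congr1 fst e'; by have /= /lift_inj -> := congr1 snd e'.
exists (perm f_inj).
  rewrite inE; apply/forallP => -[b k]; apply/eqP; rewrite !permE /spt_opp /=.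
  have := spt_opp_signed hp (b, lift ord_max k).
  rewrite /spt_opp /= !fE => e.
  have /= e1 := congr1 fst e; have /= /lift_inj e2 := congr1 snd e.
  by rewrite [LHS]surjective_pairing e1 e2.
apply/permP => -[b x]; case: (unliftP ord_max x) => [k ->|->].
  by rewrite ins_lift !permE fE.
by rewrite ins_max pmax.
Qed.

(** Removing the last letter and standardising the others inverts the
    insertion. *)
Lemma sum_signed_permS (K : nmodType) n (F : {perm spt n.+1} -> K) :
  \sum_(p in signed_perm n.+1) F p =
  \sum_(p in signed_perm n) \sum_v F (ins p v).
Proof.
rewrite pair_big_dep /=.
have -> : signed_perm n.+1 =
    [set ins x.1 x.2 | x : {perm spt n} * spt n.+1 in setX (signed_perm n) setT].
  apply/setP => p; apply/idP/imsetP => [/ins_onto[s hs e]|[[s v]]].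
    by exists (s, p (false, ord_max)); rewrite // in_setX hs in_setT.
  by rewrite in_setX => /andP[/= hs _] ->; apply: ins_signed.
rewrite big_imset /=.
  by apply: eq_bigl => -[s v]; rewrite in_setX in_setT.
move=> [s v] [s' v'] _ _ /= e.
have ev : v = v'.
  have := congr1 (fun p : {perm _} => p (false, ord_max)) e.
  by rewrite !ins_max /= -!surjective_pairing.
rewrite -ev in e *; congr (_, _); apply/permP => -[b k].
have := congr1 (fun p : {perm _} => p (b, lift ord_max k)) e.
rewrite !ins_lift => {}e.
have /= e1 := congr1 fst e; have /= /lift_inj e2 := congr1 snd e.
by rewrite [LHS]surjective_pairing [RHS]surjective_pairing e1 e2.
Qed.

Lemma signed_perm0 : signed_perm 0 = [set 1%g].
Proof.
apply/setP => p; rewrite !inE; apply/forallP/eqP => [_|_ [? []] //].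
by apply/permP => -[? []].
Qed.

(** * Ascents and inversions under insertion *)

Lemma ltr_spt n (x y : spt n) : (spt_int x < spt_int y) =
  match x.1, y.1 with
  | false, false => (x.2 < y.2)%N
  | true, true => (y.2 < x.2)%N
  | b, _ => b end.
Proof. by case: x y => [[] i] [[] j]; rewrite /spt_int /=; lia. Qed.

Definition widen_spt {n} (h : 'I_n.+1) (x : spt n) : spt n.+1 := (x.1, lift h x.2).

Lemma ltr_widen_spt n h (x y : spt n) :
  (spt_int (widen_spt h x) < spt_int (widen_spt h y)) = (spt_int x < spt_int y).
Proof.
rewrite !ltr_spt /=; case: x y => [[] i] [[] j] //=; rewrite /bump; lia.
Qed.

Lemma widen_sptN n h (x : spt n) :
  - spt_int (widen_spt h x) = spt_int (widen_spt h (spt_opp x)).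
Proof. by rewrite -spt_intN. Qed.

Lemma sp_val_ins_lt n (p : {perm spt n}) v (k : 'I_n) :
  sp_val (ins p v) k.+1 = spt_int (widen_spt v.2 (p (false, k))).
Proof. by rewrite -(lift_max k) sp_val_ord ins_lift. Qed.

Lemma sp_val_ins_max n (p : {perm spt n}) v : sp_val (ins p v) n.+1 = spt_int v.
Proof.
by have /= -> := sp_val_ord (ins p v) ord_max; rewrite ins_max /= -surjective_pairing.
Qed.

Definition asc {n} (p : {perm spt n}) i := sp_val p i < sp_val p i.+1.

(** Whether an ascent is created when the letter [v] is inserted after the last
    letter [z]. If [z] has the absolute value of [v], it is shifted away from 0,
    hence above a positive [v] and below a negative one: this is why one
    inequality is strict and the other is not. For [n = 0] the value [z = 0]
    gives the comparison of 0 with the first letter. *)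
Definition asc_last {n} (z : int) (v : spt n.+1) : bool :=
  if v.1 then z < - v.2%:Z else z <= v.2%:Z.

Lemma asc_ins_lt n (p : {perm spt n}) v i : (i < n)%N -> asc (ins p v) i = asc p i.
Proof.
case: i => [|i] ltin; rewrite /asc.
  rewrite (sp_val_ins_lt p v (Ordinal ltin)) (sp_val_ord p (Ordinal ltin)) /=.
  by rewrite !sp_val0; case: (p _) => -[] k; rewrite /spt_int /=; lia.
rewrite (sp_val_ins_lt p v (Ordinal ltin)) (sp_val_ord p (Ordinal ltin)) /=.
have /= -> := sp_val_ins_lt p v (Ordinal (ltnW ltin)).
have /= -> := sp_val_ord p (Ordinal (ltnW ltin)).
exact: ltr_widen_spt.
Qed.

Lemma asc_ins_max n (p : {perm spt n}) v :
  asc (ins p v) n = asc_last (sp_val p n) v.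
Proof.
rewrite /asc sp_val_ins_max /asc_last; case: n p v => [|n] p [b h] /=.
  by rewrite !sp_val0; case: b; rewrite /spt_int /=; lia.
have := sp_val_ins_lt p (b, h) ord_max; rewrite /= => ->.
have := sp_val_ord p ord_max; rewrite /= => ->.
case: (p _) => c k /=; case: b; case: c; rewrite /spt_int /=; rewrite /bump; lia.
Qed.

Lemma card_pairs_sum n (Q : nat -> nat -> bool) :
  #|[set ij : 'I_n.+1 * 'I_n.+1 | (0 < ij.1 < ij.2)%N && Q ij.1 ij.2]| =
  (\sum_(j < n) \sum_(i < j) Q i.+1 j.+1)%N.
Proof.
rewrite -sum1_card big_mkcond /=.
rewrite (eq_bigr (fun ij : 'I_n.+1 * 'I_n.+1 =>
   ((0 < ij.1 < ij.2)%N && Q ij.1 ij.2 : nat))); last first.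
  by move=> ij _; rewrite inE; case: ifP.
rewrite -(pair_bigA _ (fun i j : 'I_n.+1 => ((0 < i < j)%N && Q i j : nat))) /=.
rewrite exchange_big big_ord_recl big1 ?add0n; last first.
  by move=> i _; rewrite ltn0 andbF.
apply: eq_bigr => j _; rewrite big_ord_recl /= add0n.
rewrite (big_ord_widen n (fun i => (Q i.+1 j.+1 : nat))) 1?ltnW // [RHS]big_mkcond /=.
by apply: eq_bigr => i _; rewrite /bump /= !add1n ltnS; case: ifP.
Qed.

Lemma card_ord_sum n (Q : nat -> bool) :
  #|[set i : 'I_n | Q i]| = (\sum_(i < n) Q i)%N.
Proof.
rewrite -sum1_card big_mkcond /=.
by apply: eq_bigr => i _; rewrite inE; case: ifP.
Qed.

(** Grouping [invB] by the later position of each pair, so that inserting a last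
    letter only adds the last group. *)
Definition inv_at {n} (p : {perm spt n}) (j : nat) : nat :=
  (\sum_(i < j) ((sp_val p j.+1 < sp_val p i.+1)%R
                 + (sp_val p j.+1 < - sp_val p i.+1)%R)
   + (sp_val p j.+1 < 0)%R)%N.

Lemma invB_sum n (p : {perm spt n}) : invB p = (\sum_(j < n) inv_at p j)%N.
Proof.
rewrite /invB.
rewrite (card_pairs_sum n (fun i j => sp_val p j < sp_val p i)).
rewrite (card_pairs_sum n (fun i j => sp_val p j < - sp_val p i)).
rewrite (card_ord_sum n.+1 (fun i => (0 < i)%N && (sp_val p i < 0))).
rewrite [X in (_ + X)%N]big_ord_recl /= add0n -!big_split /=.
by apply: eq_bigr => j _; rewrite /inv_at big_split.
Qed.

(** The number of elements of [{-(n+1), ..., -1, 1, ..., n+1}] greater than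
    [v]. *)
Definition code {n} (v : spt n.+1) : nat := if v.1 then (n.+1 + v.2)%N else (n - v.2)%N.

Lemma sum_ltn_ord n m : (\sum_(i < n) (i < m)%N = minn n m)%N.
Proof. by elim: n => [|n IHn]; rewrite ?big_ord0 ?big_ord_recr /= ?IHn; lia. Qed.

(** The two kinds of pairs together compare [v] with all the shifted letters
    [x] and [- x], a set that does not depend on [p] since [p] permutes the
    signed points; the condition [v < 0] accounts for [- v]. *)
Lemma inv_at_ins_max n (p : {perm spt n}) v : p \in signed_perm n ->
  inv_at (ins p v) n = code v.
Proof.
move=> hp; rewrite /inv_at sp_val_ins_max.
pose G (x : spt n) : nat := (spt_int v < spt_int (widen_spt v.2 x))%R.
rewrite (eq_bigr (fun i => G (p (false, i)) + G (p (true, i)))%N); last first.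
  move=> i _; rewrite sp_val_ins_lt widen_sptN -(spt_opp_signed hp).
  by rewrite /spt_opp.
rewrite big_split /=.
have -> : (\sum_(i < n) G (p (false, i)) + \sum_(i < n) G (p (true, i)) =
           \sum_x G (p x))%N.
  by rewrite big_spt addnC.
rewrite -(reindex_inj (@perm_inj _ p) (P := xpredT) (F := G)) /=.
rewrite big_spt {}/G /=.
case: v => -[] h; rewrite /code /=.
  rewrite (eq_bigr (fun i : 'I_n => (i < h)%N : nat)); last first.
    by move=> i _; rewrite ltr_spt /= /bump; lia.
  rewrite sum_ltn_ord sum1_card card_ord; have := ltn_ord h; lia.
rewrite big1 // add0n addn0.
rewrite (eq_bigr (fun i : 'I_n => (rev_ord i < n - h)%N : nat)); last first.
  by move=> i _; rewrite ltr_spt /= /bump; have := ltn_ord i; have := ltn_ord h; lia.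
rewrite -(reindex_inj rev_ord_inj (P := xpredT)
  (F := fun i : 'I_n => (i < n - h)%N : nat)).
rewrite sum_ltn_ord; lia.
Qed.

Lemma invB_ins n (p : {perm spt n}) v : p \in signed_perm n ->
  invB (ins p v) = (invB p + code v)%N.
Proof.
move=> hp; rewrite !invB_sum big_ord_recr /= inv_at_ins_max //; congr (_ + _)%N.
apply: eq_bigr => j _; rewrite /inv_at sp_val_ins_lt sp_val_ord.
congr (_ + nat_of_bool _)%N; last by case: (p _) => -[] k; rewrite /spt_int.
apply: eq_bigr => i _.
have lein : (i < n)%N by apply: ltn_trans (ltn_ord j).
have := sp_val_ins_lt p v (Ordinal lein); rewrite /= => ->.
have := sp_val_ord p (Ordinal lein); rewrite /= => ->.
by rewrite widen_sptN -spt_intN !ltr_widen_spt.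
Qed.

(** * Weights recording the ascent set *)

Definition asc_weight {K : fieldType} (g : nat -> bool -> K) {n}
    (p : {perm spt n}) : K :=
  \prod_(i < n) g i (asc p i).

Lemma asc_weight_ins (K : fieldType) (g : nat -> bool -> K) n (p : {perm spt n}) v :
  asc_weight g (ins p v) = asc_weight g p * g n (asc_last (sp_val p n) v).
Proof.
rewrite /asc_weight big_ord_recr /= asc_ins_max; congr (_ * _).
by apply: eq_bigr => i _; rewrite asc_ins_lt.
Qed.

Lemma sp_val_neq n (p : {perm spt n}) i : (i < n)%N -> sp_val p i != sp_val p i.+1.
Proof.
move=> ltin; rewrite (sp_val_ord p (Ordinal ltin)).
case: i ltin => [|i] ltin; first by case: (p _) => -[].
have := sp_val_ord p (Ordinal (ltnW ltin)); rewrite /= => ->.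
apply/eqP => /(@spt_int_inj _)/perm_inj[] /eqP; lia.
Qed.

(** The weight whose product over the positions is the monomial of [Bhat] in [t]
    and [s]. *)
Definition alt_weight (K : fieldType) (s t : K) i (a : bool) : K :=
  if odd i then (if a then 1 else t) else (if a then s else 1).

(** Consecutive letters differ, so a position is a descent if and only if it is
    not an ascent. *)
Lemma odes_easc_weight (K : fieldType) (s t : K) n (p : {perm spt n}) :
  t ^+ odesB p * s ^+ eascB p = asc_weight (alt_weight s t) p.
Proof.
rewrite /odesB (card_ord_sum n (fun i => odd i && (sp_val p i.+1 < sp_val p i))).
rewrite /eascB (card_ord_sum n (fun i => ~~ odd i && (sp_val p i < sp_val p i.+1))).
rewrite -!prodrXr -big_split; apply: eq_bigr => i _ /=.
rewrite /alt_weight /asc.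
have := sp_val_neq p (ltn_ord i); rewrite neq_lt.
case: ltgtP => // _ _; case: odd; rewrite /= ?expr0 ?expr1 ?mulr1 ?mul1r //.
Qed.

(** * q-binomial coefficients *)

Section QSeries.

Variables (K : fieldType) (q : K).
Hypothesis qintS_neq0 : forall j, qint j.+1 q != 0.

Lemma qintS j : qint j.+1 q = qint j q + q ^+ j.
Proof. by rewrite /qint big_ord_recr. Qed.

Lemma qint1 : qint 1 q = 1.
Proof. by rewrite qintS /qint big_ord0 add0r. Qed.

Lemma qintD a b : qint (a + b) q = qint a q + q ^+ a * qint b q.
Proof.
elim: b => [|b IHb]; first by rewrite addn0 {3}/qint big_ord0 mulr0 addr0.
by rewrite addnS !qintS IHb exprD; ring.
Qed.

Lemma qfact0 : qfact 0 q = 1.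
Proof. by rewrite /qfact big_geq. Qed.

Lemma qfactS n : qfact n.+1 q = qfact n q * qint n.+1 q.
Proof. by rewrite /qfact big_nat_recr. Qed.

Lemma qfact_neq0 n : qfact n q != 0.
Proof. by elim: n => [|n IHn]; rewrite ?qfact0 ?oner_neq0 // qfactS mulf_neq0. Qed.

(** The Gaussian binomial coefficient with top [a + b] and bottom [a]; indexed by
    the two parts, it never involves a vanishing case. *)
Definition qbin a b : K := qfact (a + b) q / (qfact a q * qfact b q).

Lemma qbin0n b : qbin 0 b = 1.
Proof. by rewrite /qbin qfact0 mul1r divff ?qfact_neq0. Qed.

Lemma qbinn0 a : qbin a 0 = 1.
Proof. by rewrite /qbin addn0 qfact0 mulr1 divff ?qfact_neq0. Qed.

Lemma qbin_pascal a b :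
  qbin a.+1 b.+1 = qbin a b.+1 + q ^+ a.+1 * qbin a.+1 b.
Proof.
have := qfact_neq0 a; have := qfact_neq0 b; have := qfact_neq0 (a + b).
have := qintS_neq0 a; have := qintS_neq0 b => ? ? ? ? ?.
rewrite /qbin addSn addnS !addSn !qfactS.
have -> : qint (a + b).+2 q = qint a.+1 q + q ^+ a.+1 * qint b.+1 q.
  by rewrite -qintD addSn addnS.
by field; do ?[apply/andP; split].
Qed.

Lemma qbin_hockey_stick m k :
  \sum_(c < m.+1) q ^+ c * qbin c k = qbin m k.+1.
Proof.
elim: m => [|m IHm]; first by rewrite big_ord_recr big_ord0 /= !qbin0n add0r mulr1.
by rewrite big_ord_recr /= IHm -qbin_pascal.
Qed.

(** * Counting increasing extensions *)

(** The least total code of [a] negative letters inserted in increasing order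
    after [n] others, that is, the sum of [n + i] for [1 <= i <= a]. *)
Definition neg_exp n a := (a * n + 'C(a.+1, 2))%N.

Lemma neg_expS n a : neg_exp n a.+1 = (n.+1 + neg_exp n.+1 a)%N.
Proof. by rewrite /neg_exp binS bin1; lia. Qed.

(** The q-count of the increasing extensions by [k] letters of a signed
    permutation of size [n] with last letter [- r.+1]; [a] is the number of
    negative letters among the new ones. *)
Definition block_neg k n r : K :=
  \sum_(a < k.+1) q ^+ neg_exp n a * qbin r a * qbin (n + a) (k - a).

(** The first new letter is either positive, in which case all the new letters
    are, or it is [- h.+1] with [h <= r], in which case [n.+1 + h] is its code. The
    identity is the hockey-stick sum over [h] for each number of negative
    letters. *)
Lemma block_negS k n r :
  block_neg k.+1 n r =
  qbin n k.+1 + \sum_(h < r.+1) q ^+ (n.+1 + h) * block_neg k n.+1 h.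
Proof.
rewrite /block_neg big_ord_recl /= subn0 addn0 qbinn0 mulr1; congr (_ + _).
  by rewrite /neg_exp mul0n mul1r.
under [RHS]eq_bigr do rewrite mulr_sumr.
rewrite exchange_big; apply: eq_bigr => a _.
rewrite /bump /= add1n subSS addnS -addSn neg_expS -qbin_hockey_stick.
rewrite mulr_sumr mulr_suml; apply: eq_bigr => h _.
by rewrite !exprD; ring.
Qed.

Lemma block_neg0 n r : block_neg 0 n r = 1.
Proof.
rewrite /block_neg big_ord_recl big_ord0 /= !qbinn0 /neg_exp mul0n.
by rewrite expr0; ring.
Qed.

(** The q-count of the increasing extensions by [k] letters of a signed
    permutation of size [n] with last letter [z]. After [z >= 0] all the new
    letters are positive, and they are a multiset over the gaps above [z]. *)
Definition incr_count k n (z : int) : K :=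
  match z with Posz m => qbin (n - m) k | Negz r => block_neg k n r end.

Lemma incr_count0 n z : incr_count 0 n z = 1.
Proof. by case: z => m /=; rewrite ?qbinn0 ?block_neg0. Qed.

(** Summing over the first of [k.+1] increasing letters. The lower bound on [z]
    goes one below the least letter, so that the phantom value [- n.+1], below
    every letter that can be inserted, is covered. *)
Lemma incr_countS k n (z : int) : - n.+1%:Z <= z <= n%:Z ->
  \sum_(v : spt n.+1) (asc_last z v)%:R * q ^+ code v * incr_count k n.+1 (spt_int v)
  = incr_count k.+1 n z.
Proof.
move=> zn; rewrite big_spt.
have -> : \sum_(h < n.+1) (asc_last z (true, h))%:R * q ^+ code (true, h)
            * incr_count k n.+1 (spt_int (true, h)) =
    if z is Negz r then \sum_(h < r.+1) q ^+ (n.+1 + h) * block_neg k n.+1 h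
    else 0.
  case: z zn => r zn.
    rewrite big1 // => h _; rewrite [asc_last _ _](_ : _ = false) ?mul0r //.
    by rewrite /asc_last /=; lia.
  rewrite (big_ord_widen n.+1 (fun h => q ^+ (n.+1 + h) * block_neg k n.+1 h));
    last by lia.
  rewrite [RHS]big_mkcond /=; apply: eq_bigr => h _.
  have -> : asc_last (Negz r) (true, h) = (h < r.+1)%N by rewrite /asc_last /=; lia.
  by case: ifP => _; rewrite ?mul1r ?mul0r.
have -> : \sum_(h < n.+1) (asc_last z (false, h))%:R * q ^+ code (false, h)
            * incr_count k n.+1 (spt_int (false, h)) =
    qbin (if z is Posz m then n - m else n)%N k.+1.
  rewrite -qbin_hockey_stick (reindex_inj rev_ord_inj) /=.
  rewrite (big_ord_widen n.+1 (fun c => q ^+ c * qbin c k));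
    last by case: z zn => m; lia.
  rewrite [RHS]big_mkcond /=; apply: eq_bigr => h _; have ltn := ltn_ord h.
  rewrite /code /= !subSS subKn; last by rewrite -ltnS.
  have -> : asc_last z (false, rev_ord h) =
            (h < (if z is Posz m then n - m else n).+1)%N.
    by rewrite /asc_last /=; case: z zn => m zn; lia.
  by case: ifP => _; rewrite ?mul1r ?mul0r.
case: z zn => m zn; first exact: add0r.
by rewrite /= block_negS addrC.
Qed.

(** An unconstrained first letter of a block is one that follows the phantom
    last letter [- n.+1], whose ascent condition always holds. *)
Lemma sum_incr_count k n :
  \sum_(v : spt n.+1) q ^+ code v * incr_count k n.+1 (spt_int v) =
  block_neg k.+1 n n.
Proof.
rewrite -[RHS]/(incr_count k.+1 n (Negz n)) -incr_countS; last by lia.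
apply: eq_bigr => v _; rewrite (_ : asc_last _ _ = true) ?mul1r //.
by case: v => -[] h; rewrite /asc_last /=; have := ltn_ord h; lia.
Qed.

(** By induction on [k] with [n] varying: Pascal's rule splits off the factor
    [1 + q ^ n.+1] and turns [n] into [n.+1] in the remaining sum. *)
Lemma qbinomial_theorem n k :
  \sum_(a < k.+1) q ^+ neg_exp n a * qbin a (k - a) =
  \prod_(j < k) (1 + q ^+ (n + j.+1)).
Proof.
elim: k n => [|k IHk] n.
  by rewrite big_ord_recr !big_ord0 /= qbinn0 /neg_exp mul0n expr0 add0r mulr1.
have -> : \sum_(a < k.+2) q ^+ neg_exp n a * qbin a (k.+1 - a) =
   \sum_(a < k.+1) q ^+ neg_exp n a * q ^+ a * qbin a (k - a)
   + \sum_(a < k.+1) q ^+ neg_exp n a.+1 * qbin a (k - a).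
  rewrite big_ord_recl [X in _ = X + _]big_ord_recl.
  rewrite [X in _ + X = _]big_ord_recr [X in _ = _ + X]big_ord_recr /= !qbin0n.
  rewrite expr0 /bump /= add1n subSS subnn !qbinn0 !mulr1 -!addrA; congr (_ + _).
  rewrite !addrA; congr (_ + _); rewrite -big_split; apply: eq_bigr => a _ /=.
  rewrite /bump /= !add1n !subSS; have -> : (k - a = (k - a.+1).+1)%N.
    by have := ltn_ord a; lia.
  by rewrite qbin_pascal; ring.
rewrite big_ord_recl /= addn1.
rewrite (eq_bigr (fun j : 'I_k => 1 + q ^+ (n.+1 + j.+1))); last first.
  by move=> j _; rewrite addSnnS.
rewrite -IHk mulrDl mul1r mulr_sumr; congr (_ + _); apply: eq_bigr => a _.
  by rewrite -exprD (_ : neg_exp n a + a = neg_exp n.+1 a)%N // /neg_exp; lia.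
by rewrite neg_expS exprD mulrA.
Qed.

(** Both products of two q-binomials are the q-multinomial coefficient with parts
    [n], [a], [k - a], which leaves the q-binomial theorem. *)
Lemma block_negE n k :
  block_neg k n n = qbin n k * \prod_(j < k) (1 + q ^+ (n + j.+1)).
Proof.
rewrite -qbinomial_theorem mulr_sumr; apply: eq_bigr => a _.
have le_ak : (a <= k)%N by rewrite -ltnS.
rewrite -mulrA [RHS]mulrCA; congr (_ * _).
rewrite /qbin subnKC // -(addnA n) subnKC //.
have := qfact_neq0 a; have := qfact_neq0 n; have := qfact_neq0 k.
have := qfact_neq0 (n + a); have := qfact_neq0 (k - a) => ? ? ? ? ?.
by field; do ?[apply/andP; split].
Qed.

Lemma sp_val_bound n (p : {perm spt n}) : - n.+1%:Z <= sp_val p n <= n%:Z.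
Proof.
case: n p => [|n] p; first by rewrite sp_val0.
have /= -> := sp_val_ord p ord_max.
by case: (p _) => -[] h; rewrite /spt_int /=; have := ltn_ord h; lia.
Qed.

(** * The recurrence for weighted sums *)

(** The weighted sum over the signed permutations of size [n + k] in which the
    positions [n, ..., n + k - 1] are ascents, these having weight 1, organised
    by the first [n] letters. For [k = 0] nothing is forced. *)
Definition incr_sum g n k : K :=
  \sum_(p in signed_perm n)
    asc_weight g p * q ^+ invB p * incr_count k n (sp_val p n).

Lemma incr_sum0 g k : incr_sum g 0 k = 1.
Proof.
rewrite /incr_sum signed_perm0 big_set1 sp_val0 /= qbin0n invB_sum.
by rewrite /asc_weight !big_ord0 !mulr1.
Qed.

(** Write the weight at position [n] as a constant plus a multiple of the ascent
    indicator: the constant part starts a new block of [k.+1] letters, the other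
    part prolongs the last block by one letter to the left. *)
Lemma incr_sumS g n k :
  incr_sum g n.+1 k = g n false * incr_sum g n 0 * block_neg k.+1 n n
    + (g n true - g n false) * incr_sum g n k.+1.
Proof.
rewrite /incr_sum sum_signed_permS.
move: (block_neg _ _ _) (sum_incr_count k n) => W defW.
rewrite !mulr_sumr mulr_suml -big_split /=; apply: eq_bigr => p hp.
rewrite incr_count0 -(incr_countS k (sp_val_bound p)) -defW.
rewrite !mulr_sumr -big_split; apply: eq_bigr => v _ /=.
rewrite asc_weight_ins invB_ins // sp_val_ins_max exprD.
by case: asc_last => /=; ring.
Qed.

Lemma incr_sum_Bone n : incr_sum (fun _ _ => 1) n 0 = Bone n q.
Proof.
apply: eq_bigr => p _; rewrite incr_count0 mulr1 /asc_weight.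
by rewrite big1_eq mul1r.
Qed.

(** For the weight constantly [1] no ascent is ever forced, so [incr_sumS] adds
    the letters freely, as blocks of length 1. *)
Lemma BoneE n : Bone n q = qfact n q * \prod_(j < n) (1 + q ^+ j.+1).
Proof.
rewrite -incr_sum_Bone; elim: n => [|n IHn].
  by rewrite incr_sum0 big_ord0 qfact0 mulr1.
rewrite incr_sumS IHn subrr mul0r addr0 mul1r block_negE big_ord_recr.
rewrite big_ord_recr big_ord0 /= mul1r addn1 /qbin addn1 !qfactS qfact0.
rewrite qint1 !mul1r.
by have := qfact_neq0 n => ?; field; do ?[apply/andP; split].
Qed.

Lemma qint_double j : qint (j + j) q = qint j q * (1 + q ^+ j).
Proof. by rewrite qintD; ring. Qed.

Lemma Bone_neq0 n : Bone n q != 0.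
Proof.
rewrite BoneE mulf_neq0 ?qfact_neq0 //; apply/prodf_neq0 => j _.
have := qintS_neq0 (j + j.+1); rewrite -addSn qint_double mulf_eq0.
by case/norP.
Qed.

(** The factor by which appending a block of [k] increasing letters multiplies
    the inversion generating function. *)
Lemma block_neg_Bone n k :
  block_neg k n n = Bone (n + k) q / (Bone n q * qfact k q).
Proof.
have := Bone_neq0 n; have := qfact_neq0 k; have := qfact_neq0 n.
rewrite block_negE !BoneE big_split_ord /= mulf_eq0 negb_or.
move=> nfact kfact /andP[_ nprod].
rewrite /qbin; set P := \prod_(j < k) _.
have -> : P = \prod_(j < k) (1 + q ^+ (n + j).+1).
  by apply: eq_bigr => j _; rewrite addnS.
by field; do ?[apply/andP; split].
Qed.

Definition norm_sum g n : K := incr_sum g n 0 / Bone n q.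

(** Iterating [incr_sumS] down to size 0; [m] is the start of the last block. *)
Lemma incr_sum_expand g n k :
  incr_sum g n k / Bone (n + k) q =
    (\prod_(0 <= i < n) (g i true - g i false)) / Bone (n + k) q
    + \sum_(m < n) g m false * norm_sum g m
        * (\prod_(m.+1 <= i < n) (g i true - g i false)) / qfact (n - m + k) q.
Proof.
elim: n k => [|n IHn] k; first by rewrite incr_sum0 big_ord0 big_geq // addr0.
have := Bone_neq0 (n + k.+1); have := qfact_neq0 k.+1; have := Bone_neq0 n => ? ? ?.
rewrite incr_sumS block_neg_Bone addSnnS mulrDl.
rewrite -[X in _ + X]mulrA IHn big_ord_recr big_nat_recr //=.
rewrite (@big_geq _ _ _ n.+1) // subSnn add1n.
set al := g n true - g n false; rewrite [X in _ + X]mulrDr [LHS]addrC.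
rewrite [al * \sum_(m < n) _]mulr_sumr -addrA; congr (_ + _); first by ring.
congr (_ + _); last by rewrite /norm_sum; field; do ?[apply/andP; split].
apply: eq_bigr => m _; rewrite big_nat_recr ?ltn_ord //=.
rewrite (_ : n - m + k.+1 = n.+1 - m + k)%N; last by have := ltn_ord m; lia.
rewrite /al; move: (norm_sum g m) (qfact _ q)^-1 (\prod_(m.+1 <= i < n) _).
by move=> N Q P; ring.
Qed.

Lemma norm_sum_rec g n :
  norm_sum g n =
    (\prod_(0 <= i < n) (g i true - g i false)) / Bone n q
    + \sum_(m < n) g m false * norm_sum g m
        * (\prod_(m.+1 <= i < n) (g i true - g i false)) / qfact (n - m) q.
Proof.
have := incr_sum_expand g n 0; rewrite addn0 -/(norm_sum g n) => ->.
by congr (_ + _); apply: eq_bigr => m _; rewrite addn0.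
Qed.

End QSeries.

(** * Power series: constants, sine and cosine *)

Section Fps.

Variable K : fieldType.
Implicit Types (c d : K) (f g e : fps K).

Lemma fcoefD f g n : fcoef (f + g) n = fcoef f n + fcoef g n.
Proof. by []. Qed.

Lemma fcoefN f n : fcoef (- f) n = - fcoef f n.
Proof. by []. Qed.

Lemma fcoefM f g n : fcoef (f * g) n = \sum_(k < n.+1) fcoef f k * fcoef g (n - k).
Proof. by []. Qed.

Lemma fcoefM0 f g : fcoef (f * g) 0 = fcoef f 0 * fcoef g 0.
Proof. by rewrite fcoefM big_ord_recl big_ord0 [LHS]addr0. Qed.

Lemma fcoef_scale c f n : fcoef (fps_scale c f) n = c ^+ n * fcoef f n.
Proof. by []. Qed.

Lemma fps_constD c d : (c + d)%:S = c%:S + d%:S.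
Proof. by apply/fpsP => -[|n] //=; rewrite addr0. Qed.

Lemma fps_constN c : (- c)%:S = - c%:S.
Proof. by apply/fpsP => -[|n] //=; rewrite oppr0. Qed.

Lemma fps_constB c d : (c - d)%:S = c%:S - d%:S.
Proof. by rewrite fps_constD fps_constN. Qed.

Lemma fcoef_mulC f c n : fcoef (f * c%:S) n = fcoef f n * c.
Proof.
rewrite fcoefM big_ord_recr /= subnn big1 ?add0r // => i _.
by rewrite -[(n - i)%N]prednK ?subn_gt0 ?ltn_ord // mulr0.
Qed.

Lemma fps_constM c d : (c * d)%:S = c%:S * d%:S.
Proof. by apply/fpsP => n; rewrite fcoef_mulC; case: n => [|n] //=; rewrite mul0r. Qed.

Lemma fps_const_nat n : n%:R%:S = n%:R :> fps K.
Proof.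
elim: n => [|n IHn]; first by rewrite !mulr0n.
by rewrite !mulrSr fps_constD IHn.
Qed.

Lemma fps_divC f c : c != 0 -> f / c%:S = f * c^-1%:S.
Proof.
move=> c0; have uc : c%:S \is a GRing.unit by [].
by apply: (mulIr uc); rewrite divrK // -mulrA -fps_constM mulVf // mulr1.
Qed.

Lemma fcoef_cos M im e n : 2%:R != 0 :> K ->
  fcoef (fps_scale M (fps_cos im e)) n =
  if odd n then 0 else (im * M) ^+ n * fcoef e n.
Proof.
move=> two0; rewrite /fps_cos -fps_const_nat fps_divC //.
rewrite fcoef_scale fcoef_mulC fcoefD ?fcoefN !fcoef_scale.
rewrite [(- im) ^+ n]exprNn exprMn -signr_odd.
by case: odd => /=; rewrite ?expr1 ?expr0; field.
Qed.

Lemma fcoef_sin M im e n : 2%:R != 0 :> K -> im != 0 ->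
  fcoef (fps_scale M (fps_sin im e)) n =
  if odd n then (im * M) ^+ n / im * fcoef e n else 0.
Proof.
move=> two0 im0.
rewrite /fps_sin -fps_const_nat -fps_constM fps_divC ?mulf_neq0 //.
rewrite fcoef_scale fcoef_mulC fcoefD ?fcoefN !fcoef_scale.
rewrite [(- im) ^+ n]exprNn exprMn -signr_odd.
by case: odd => /=; rewrite ?expr1 ?expr0; field; rewrite ?im0 ?two0.
Qed.

Lemma fps_scale_cos_sin M im e : 2%:R != 0 :> K -> im ^+ 2 = -1 ->
  fps_scale (im * M) e * fps_scale (- im * M) e =
  fps_scale M (fps_cos im e) ^+ 2 + fps_scale M (fps_sin im e) ^+ 2.
Proof.
move=> two0 im2.
have im0 : im != 0 by rewrite -sqrf_eq0 im2 oppr_eq0 oner_eq0.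
have iS : im%:S ^+ 2 = -1 :> fps K by rewrite expr2 -fps_constM -expr2 im2 fps_constN.
set C := fps_scale M (fps_cos im e); set S := fps_scale M (fps_sin im e).
have -> : fps_scale (im * M) e = C + S * im%:S.
  apply/fpsP => n; rewrite fcoefD fcoef_mulC fcoef_cos // fcoef_sin //=.
  by case: odd; field.
have -> : fps_scale (- im * M) e = C - S * im%:S.
  apply/fpsP => n; rewrite fcoefD fcoefN fcoef_mulC fcoef_cos // fcoef_sin //=.
  rewrite mulNr exprNn -signr_odd.
  by case: odd; rewrite ?expr0 ?expr1; field.
have -> : (C + S * im%:S) * (C - S * im%:S) = C ^+ 2 - S ^+ 2 * im%:S ^+ 2 by ring.
by rewrite iS; ring.
Qed.

End Fps.

(** * The linear system *)

(** The primed variables are inverses, so that the elimination takes place in any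
    commutative ring. *)
Lemma solve_linear_system (R : comNzRingType) (s t a a' b b' m m' C S CB SB H0 H1 : R) :
  a = 1 - t -> b = s - 1 -> m ^+ 2 = - (a * b) ->
  a * a' = 1 -> b * b' = 1 -> m * m' = 1 ->
  H0 = CB + H0 * (C - 1) * b' + H1 * S * (t * m') ->
  H1 = SB * (b * m') + H0 * S * m' + H1 * (C - 1) * (t * a') ->
  let den := s + t * (C ^+ 2 + S ^+ 2) - (t * s + 1) * C in
  H0 * den = b * ((1 - t * C) * CB - t * S * SB) /\
  H1 * den = - m * ((s - C) * SB + S * CB).
Proof.
move=> ea eb em eaa ebb emm E0 E1 den.
have emm2 : a * b * m' ^+ 2 = -1.
  by rewrite -[a * b]opprK -em mulNr -exprMn emm expr1n.
have emm1 : a * b * m' = - m.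
  by rewrite -[a * b]opprK -em mulNr expr2 -mulrA emm mulr1.
have F0 : H0 * (s - C) = b * CB + t * b * m' * S * H1.
  have : b * H0 = b * CB + H0 * (C - 1) * (b * b') + H1 * S * (t * b * m').
    by rewrite {1}E0; ring.
  have -> : H0 * (s - C) = b * H0 - H0 * (C - 1) by rewrite eb; ring.
  by rewrite ebb => ->; ring.
have F1 : H1 * (1 - t * C) = - m * SB + a * m' * S * H0.
  have : a * H1 = SB * (a * b * m') + H0 * S * (a * m') + H1 * (C - 1) * (t * (a * a')).
    by rewrite {1}E1; ring.
  have -> : H1 * (1 - t * C) = a * H1 - t * H1 * (C - 1) by rewrite ea; ring.
  by rewrite eaa emm1 => ->; ring.
have -> : den = (s - C) * (1 - t * C) + t * S ^+ 2 by rewrite /den; ring.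
split.
  have -> : H0 * ((s - C) * (1 - t * C) + t * S ^+ 2) =
            H0 * (s - C) * (1 - t * C) + H0 * t * S ^+ 2 by ring.
  rewrite F0.
  have -> : (b * CB + t * b * m' * S * H1) * (1 - t * C) =
            b * CB * (1 - t * C) + t * b * m' * S * (H1 * (1 - t * C)) by ring.
  rewrite F1.
  have -> : t * b * m' * S * (- m * SB + a * m' * S * H0) =
     t * S ^+ 2 * H0 * (a * b * m' ^+ 2) - t * b * S * SB * (m * m') by ring.
  by rewrite emm emm2; ring.
have -> : H1 * ((s - C) * (1 - t * C) + t * S ^+ 2) =
          (s - C) * (H1 * (1 - t * C)) + H1 * t * S ^+ 2 by ring.
rewrite F1.
have -> : (s - C) * (- m * SB + a * m' * S * H0) =
          - m * SB * (s - C) + a * m' * S * (H0 * (s - C)) by ring.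
rewrite F0.
have -> : a * m' * S * (b * CB + t * b * m' * S * H1) =
   S * CB * (a * b * m') + t * S ^+ 2 * H1 * (a * b * m' ^+ 2) by ring.
by rewrite emm1 emm2; ring.
Qed.

#[local] Arguments fcoef : simpl never.

Section System.

Variables (K : fieldType) (s t q M im : K).
Hypothesis qintS_neq0 : forall j, qint j.+1 q != 0.
Hypothesis two_neq0 : 2%:R != 0 :> K.
Hypotheses (s_neq1 : 1 - s != 0) (t_neq1 : 1 - t != 0).
Hypothesis M_sqr : M ^+ 2 = (1 - s) * (1 - t).
Hypothesis im_sqr : im ^+ 2 = -1.

Let a := 1 - t.
Let b := s - 1.
Let w := im * M.

Lemma norm_sum_alt n :
  norm_sum q (alt_weight s t) n = Bhat n s t q / Bone n q.
Proof.
congr (_ / _); apply: eq_bigr => p _.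
by rewrite incr_count0 // mulr1 odes_easc_weight.
Qed.

Let w_sqr : w ^+ 2 = a * b.
Proof. by rewrite /w exprMn M_sqr im_sqr /a /b; ring. Qed.

Let wSS k : w ^+ k.+2 = a * b * w ^+ k.
Proof. by rewrite -w_sqr -exprD. Qed.

Lemma im_neq0 : im != 0.
Proof. by rewrite -sqrf_eq0 im_sqr oppr_eq0 oner_eq0. Qed.

Lemma M_neq0 : M != 0.
Proof. by rewrite -sqrf_eq0 M_sqr mulf_neq0. Qed.

Let a_neq0 : a != 0. Proof. exact: t_neq1. Qed.
Let b_neq0 : b != 0. Proof. by rewrite /b -opprB oppr_eq0. Qed.

(** Two consecutive factors multiply to [a * b = w ^ 2], so an odd number of
    factors leaves the first one over. *)
Lemma alt_prod m n : (m <= n)%N ->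
  \prod_(m <= i < n) (alt_weight s t i true - alt_weight s t i false) =
  w ^+ (n - m - odd (n - m))
    * (if odd (n - m) then if odd m then a else b else 1).
Proof.
move=> le_mn; rewrite -{1}(subnKC le_mn); elim: (n - m)%N => [|k IHk].
  by rewrite addn0 big_geq // mulr1.
rewrite addnS big_nat_recr ?leq_addr //= IHk {IHk} /alt_weight oddD.
case ok : (odd k) => /=.
  have -> : (k.+1 - 0 = 2 + (k - 1))%N by case: k ok => // k _; lia.
  by rewrite exprD w_sqr; case: (odd m) => /=; rewrite /a /b; ring.
by rewrite !subn0 subSS subn0; case: (odd m) => /=; rewrite /a /b; ring.
Qed.

Lemma norm_sum_alt_rec n (G := norm_sum q (alt_weight s t)) :
  G n = w ^+ (n - odd n) * (if odd n then b else 1) / Bone n q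
    + \sum_(m < n) (if odd m then t else 1) * G m
        * (w ^+ (n - m.+1 - odd (n - m.+1))
            * (if odd (n - m.+1) then if odd m then b else a else 1))
        / qfact (n - m) q.
Proof.
rewrite /G norm_sum_rec // alt_prod // subn0; congr (_ + _).
apply: eq_bigr => m _; rewrite alt_prod ?ltn_ord //= /alt_weight if_neg.
by case: (odd m).
Qed.

Let cq := fps_scale M (cosq im q).
Let sq := fps_scale M (sinq im q).
Let cB := fps_scale M (cosB im q).
Let sB := fps_scale M (sinB im q).
Let H0 := Hhat0 s t q.
Let H1 := Hhat1 s t q.

Let cqE n : fcoef cq n = if odd n then 0 else w ^+ n / qfact n q.
Proof. exact: fcoef_cos. Qed.

Let sqE n : fcoef sq n = if odd n then w ^+ n / im / qfact n q else 0.
Proof. by apply: fcoef_sin; rewrite ?im_neq0. Qed.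

Let cBE n : fcoef cB n = if odd n then 0 else w ^+ n / Bone n q.
Proof. exact: fcoef_cos. Qed.

Let sBE n : fcoef sB n = if odd n then w ^+ n / im / Bone n q else 0.
Proof. by apply: fcoef_sin; rewrite ?im_neq0. Qed.

Let mul_cq_sub1 (f : fps K) n :
  fcoef (f * (cq - 1)) n =
  \sum_(m < n) fcoef f m * (if odd (n - m) then 0 else w ^+ (n - m) / qfact (n - m) q).
Proof.
have c0 : fcoef (cq - 1) 0 = 0.
  by rewrite fcoefD fcoefN cqE expr0 qfact0 divr1 subrr.
rewrite fcoefM big_ord_recr [ord_max : nat]/= subnn c0 mulr0 [LHS]addr0.
apply: eq_bigr => m _; congr (_ * _); rewrite fcoefD fcoefN cqE.
by rewrite -[(n - m)%N]prednK ?subn_gt0 ?ltn_ord //= subr0.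
Qed.

Let mul_sq (f : fps K) n :
  fcoef (f * sq) n =
  \sum_(m < n) fcoef f m *
    (if odd (n - m) then w ^+ (n - m) / im / qfact (n - m) q else 0).
Proof.
rewrite fcoefM big_ord_recr [ord_max : nat]/= subnn sqE mulr0 [LHS]addr0.
by apply: eq_bigr => m _; rewrite sqE.
Qed.

Let H0E n : fcoef H0 n = if odd n then 0 else norm_sum q (alt_weight s t) n.
Proof. by rewrite norm_sum_alt. Qed.

Let H1E n : fcoef H1 n = if odd n then norm_sum q (alt_weight s t) n else 0.
Proof. by rewrite norm_sum_alt. Qed.

(** The even part of the recurrence. A last block starting at an even [m] has
    [n - m - 1], an odd number, forced ascents, the first of weight [a]; as
    [a = w ^ 2 / b], its weight is [w ^ (n - m) / b]. Starting at an odd [m], it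
    has an even number of them, of total weight [w ^ (n - m) / w]. *)
Lemma Hhat0_eq :
  H0 = cB + H0 * (cq - 1) * b^-1%:S + H1 * sq * (t / M)%:S.
Proof.
have [im0 M0] := (im_neq0, M_neq0).
apply/fpsP => n; rewrite !fcoefD !fcoef_mulC mul_cq_sub1 mul_sq cBE.
rewrite -addrA !mulr_suml -big_split H0E /=.
case: ifP => on.
  rewrite add0r big1 // => m _; rewrite H0E H1E oddB ?on 1?ltnW //.
  by case: odd => /=; ring.
rewrite norm_sum_alt_rec on subn0 mulr1; congr (_ + _).
apply: eq_bigr => m _; rewrite H0E H1E.
have -> : (n - m = (n - m.+1).+1)%N by have := ltn_ord m; lia.
have := qfact_neq0 qintS_neq0 (n - m.+1).+1.
have := oddB (ltn_ord m); rewrite on /= => ->.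
case: (n - m.+1)%N (oddB (ltn_ord m)) => [|k]; rewrite on /=; case: (odd m) => //= _ fk.
- by rewrite /w; field; do ?[apply/andP; split].
- by rewrite subn0 !exprS /w; field; do ?[apply/andP; split].
- by rewrite subn1 (wSS k); field; do ?[apply/andP; split].
Qed.

(** The odd part of the recurrence, where the block leaves over [b = w ^ 2 / a]
    instead of [a]. *)
Lemma Hhat1_eq :
  H1 = sB * (b / M)%:S + H0 * sq * M^-1%:S + H1 * (cq - 1) * (t / a)%:S.
Proof.
have [im0 M0] := (im_neq0, M_neq0).
apply/fpsP => n; rewrite !fcoefD !fcoef_mulC mul_cq_sub1 mul_sq sBE.
rewrite -addrA !mulr_suml -big_split H1E /=.
case: ifP => on; last first.
  rewrite mul0r add0r big1 // => m _; rewrite H0E H1E oddB ?on 1?ltnW //.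
  by case: odd => /=; ring.
have := Bone_neq0 qintS_neq0 n => Bn.
rewrite norm_sum_alt_rec on; congr (_ + _).
  case: n on Bn => // n _ Bn; rewrite subn1 /= exprS /w.
  by field; do ?[apply/andP; split].
apply: eq_bigr => m _; rewrite H0E H1E.
have -> : (n - m = (n - m.+1).+1)%N by have := ltn_ord m; lia.
have := qfact_neq0 qintS_neq0 (n - m.+1).+1.
have := oddB (ltn_ord m); rewrite on /= => ->.
case: (n - m.+1)%N (oddB (ltn_ord m)) => [|k]; rewrite on /=; case: (odd m) => //= _ fk.
- by rewrite /w; field; do ?[apply/andP; split].
- by rewrite subn1 (wSS k); field; do ?[apply/andP; split].
- by rewrite subn0 !exprS /w; field; do ?[apply/andP; split].
Qed.

(** The denominator is invertible because its constant coefficient is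
    [- M ^ 2], so Cramer's rule applies to the two equations. *)
Theorem Hhat_eq :
  let den :=
    s%:S + t%:S * fps_scale (im * M) (eq_fps q) * fps_scale (- im * M) (eq_fps q)
      - (t * s + 1)%:S * cq in
  H0 = (s - 1)%:S * ((1 - t%:S * cq) * cB - t%:S * sq * sB) / den
  /\
  H1 = (- M)%:S * ((s%:S - cq) * sB + sq * cB) / den.
Proof.
move=> den.
have uden : den \is a GRing.unit.
  have d0 : fcoef den 0 = - M ^+ 2.
    rewrite /den !(fcoefD, fcoefN, fcoefM0) cqE !fcoef_scale /fcoef /=.
    by rewrite qfact0 !expr0 invr1 M_sqr; ring.
  rewrite [_ \is a _]/(fcoef den 0 != 0) d0.
  by rewrite oppr_eq0 sqrf_eq0; exact: M_neq0.
have VC x : x != 0 -> x%:S * x^-1%:S = 1 :> fps K.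
  by move=> x0; rewrite -fps_constM mulfV.
have denE : den = s%:S + t%:S * (cq ^+ 2 + sq ^+ 2) - (t%:S * s%:S + 1) * cq.
  by rewrite /den -mulrA fps_scale_cos_sin // fps_constD fps_constM.
have [||||||||] := @solve_linear_system _ s%:S t%:S
  a%:S a^-1%:S b%:S b^-1%:S M%:S M^-1%:S cq sq cB sB H0 H1.
- by rewrite /a fps_constB.
- by rewrite /b fps_constB.
- by rewrite expr2 -!fps_constM -fps_constN -expr2 M_sqr /a /b; congr _%:S; ring.
- exact: VC.
- exact: VC.
- exact: VC M_neq0.
- by rewrite -!fps_constM -Hhat0_eq.
- by rewrite -!fps_constM -Hhat1_eq.
rewrite -denE -fps_constN => e0 e1.
by rewrite -[H0](mulrK uden) -[H1](mulrK uden) e0 e1.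
Qed.

End System.

(** * The field generated by the indeterminates *)

(** Specialising the indeterminates shows that a polynomial does not vanish. *)
Lemma mpoly_image_neq0 (K : fieldExtType Qstq) (p : {mpoly rat[3]}) (c : rat) :
  p.@[fun=> c] != 0 -> (tofrac p)%:A != 0 :> K.
Proof.
move=> pc; rewrite (fmorph_eq0 (in_alg K)) tofrac_eq0.
by apply: contra_neq pc => ->; rewrite meval0.
Qed.

Lemma qint_ind_q_neq0 (K : fieldExtType Qstq) j : qint j.+1 (ind_q%:A : K) != 0.
Proof.
have -> : qint j.+1 (ind_q%:A : K) =
    (tofrac (\sum_(k < j.+1) 'X_(@Ordinal 3 2 isT) ^+ k))%:A.
  rewrite [RHS](rmorph_sum (in_alg K \o @tofrac _)); apply: eq_bigr => k _.
  by rewrite [RHS](rmorphXn (in_alg K \o @tofrac _)).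
apply: (@mpoly_image_neq0 _ _ 1); rewrite rmorph_sum /=.
under eq_bigr do rewrite rmorphXn /= mevalXU expr1n.
by rewrite sumr_const card_ord pnatr_eq0.
Qed.

Lemma sub_ind_neq0 (K : fieldExtType Qstq) (i : 'I_3) :
  1 - (tofrac 'X_i)%:A != 0 :> K.
Proof.
have -> : 1 - (tofrac 'X_i)%:A = (tofrac (1 - 'X_i))%:A :> K.
  by rewrite [RHS](rmorphB (in_alg K \o @tofrac _)) (rmorph1 (in_alg K \o @tofrac _)).
apply: (@mpoly_image_neq0 _ _ 0).
by rewrite rmorphB /= rmorph1 mevalXU subr0 oner_neq0.
Qed.

Theorem theorem7 (K : fieldExtType Qstq) (M im : K) :
  let s : K := ind_s%:A in
  let t : K := ind_t%:A in
  let q : K := ind_q%:A in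
  M ^+ 2 = (1 - s) * (1 - t) ->
  im ^+ 2 = -1 ->
  let cq := fps_scale M (cosq im q) in
  let sq := fps_scale M (sinq im q) in
  let cB := fps_scale M (cosB im q) in
  let sB := fps_scale M (sinB im q) in
  let den :=
    s%:S + t%:S * fps_scale (im * M) (eq_fps q) * fps_scale (- im * M) (eq_fps q)
      - (t * s + 1)%:S * cq in
  Hhat0 s t q = (s - 1)%:S * ((1 - t%:S * cq) * cB - t%:S * sq * sB) / den
  /\
  Hhat1 s t q = (- M)%:S * ((s%:S - cq) * sB + sq * cB) / den.
Proof.
move=> s t q M_sqr im_sqr; apply: Hhat_eq => //.
- by move=> j; apply: qint_ind_q_neq0.
- have -> : 2%:R = (tofrac 2%:R)%:A :> K.
    by rewrite [RHS](rmorph_nat (in_alg K \o @tofrac _)).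
  by apply: (@mpoly_image_neq0 _ _ 0); rewrite rmorph_nat pnatr_eq0.
- exact: sub_ind_neq0.
- exact: sub_ind_neq0.
Qed.
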